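(* Let $\mathbf{K}$ be a regular variety of $\Sigma$-structures satisfying the amalgamation property. Then any logic $l$ over $\Sigma$ with an algebraic semantics in $\mathbf{K}$ given by a regular equation satisfies the Craig interpolation property.
   Context: $Fm(X)$ is the absolutely free $\Sigma$-structure (formula algebra) on a set $X$ of variables. A logic over $\Sigma$ is a pair $l=(\Sigma,\vdash_l)$ with $\vdash_l$ a reflexive, monotone, cut-closed, finitary and substitution-invariant consequence relation on $Fm(X)$. An equation is a pair of formulas $\langle\varphi,\psi\rangle$, also written $\varphi\approx\psi$; it is regular if $\varphi$ and $\psi$ contain exactly the same variables. A variety is regular if it can be defined by regular equations. $l$ has an algebraic semantics in $\mathbf{K}$ given by an equation $\delta(x)\approx\epsilon(x)$ (in at most the variable $x$) if for all $\Gamma\cup\{\varphi\}\subseteq Fm(X)$: $\Gamma\vdash_l\varphi$ iff $\{\delta(\gamma)\approx\epsilon(\gamma)\mid\gamma\in\Gamma\}\models_{\mathbf{K}}\delta(\varphi)\approx\epsilon(\varphi)$, where $\Theta\models_{\mathbf{K}}\varphi\approx\psi$ means that for every $A\in\mathbf{K}$ and every homomorphism $h:Fm(X)\to A$ with $h(\eta)=h(\nu)$ for all $\eta\approx\nu$ in $\Theta$ one has $h(\varphi)=h(\psi)$. Amalgamation property of $\mathbf{K}$: for all $A,B,C\in\mathbf{K}$ and injective homomorphisms $i_B:A\to B$, $i_C:A\to C$ there are $D\in\mathbf{K}$ and injective homomorphisms $e_B:B\to D$, $e_C:C\to D$ with $e_B\circ i_B=e_C\circ i_C$. Craig (entailment)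 interpolation property: for every set of formulas $\Gamma$ and every formula $\varphi$, if $\Gamma\vdash_l\varphi$ then there is a set of formulas $\Gamma'$ with variables in $var(\Gamma)\cap var(\varphi)$ such that $\Gamma\vdash_l\gamma'$ for all $\gamma'\in\Gamma'$ and $\Gamma'\vdash_l\varphi$. Here $var$ denotes the set of variables occurring. *)

(* Defs.v *)
From mathcomp Require Import all_boot.
From mathcomp Require Import boolp classical_sets functions cardinality.

Set Implicit Arguments.
Unset Strict Implicit.
Unset Printing Implicit Defensive.

Local Open Scope classical_set_scope.

Record signature := Signature {
  op_sym : Type;
  arity : op_sym -> nat
}.

Record algebra (S : signature) := Algebra {
  carrier :> Type;
  interp : forall o : op_sym S, ('I_(arity o) -> carrier) -> carrier
}.

Definition is_hom (S : signature) (A B : algebra S) (h : A -> B) : Prop :=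
  forall (o : op_sym S) (a : 'I_(arity o) -> A),
    h (interp a) = interp (fun i => h (a i)).

Inductive formula (S : signature) (X : Type) : Type :=
| Var (x : X)
| App (o : op_sym S) (args : 'I_(arity o) -> formula S X).

Arguments Var {S X} x.
Arguments App {S X} o args.

Definition Fm (S : signature) (X : Type) : algebra S :=
  @Algebra S (formula S X) (@App S X).

Fixpoint eval (S : signature) (X : Type) (A : algebra S) (v : X -> A)
    (t : formula S X) : A :=
  match t with
  | Var x => v x
  | App o args => interp (fun i => eval v (args i))
  end.

Fixpoint vars (S : signature) (X : Type) (t : formula S X) : set X :=
  match t with
  | Var x => [set x]
  | App o args => \bigcup_i vars (args i)
  end.

Definition set_vars (S : signature) (X : Type) (G : set (formula S X)) : set X :=
  \bigcup_(g in G) vars g.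

Definition equation (S : signature) (X : Type) : Type :=
  (formula S X * formula S X)%type.

Definition regular (S : signature) (X : Type) (e : equation S X) : Prop :=
  vars e.1 = vars e.2.

(** The defining equations of a variety are written in the countable supply
    [nat] of variables, independently of the variables of the logic: an
    equation has finitely many variables, so nothing is lost, and the notion
    does not degenerate when the logic has few variables. *)
Definition satisfies (S : signature) (A : algebra S) (e : equation S nat) : Prop :=
  forall h : Fm S nat -> A, is_hom h -> h e.1 = h e.2.

Definition defined_by (S : signature) (K : algebra S -> Prop)
    (E : set (equation S nat)) : Prop :=
  forall A : algebra S, K A <-> (forall e, E e -> satisfies A e).

Definition regular_variety (S : signature) (K : algebra S -> Prop) : Prop :=
  exists E : set (equation S nat),
    (forall e, E e -> regular e) /\ defined_by K E.

Definition amalgamation_property (S : signature) (K : algebra S -> Prop) : Prop :=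
  forall (A B C : algebra S), K A -> K B -> K C ->
  forall (iB : A -> B) (iC : A -> C),
    is_hom iB -> injective iB -> is_hom iC -> injective iC ->
  exists (D : algebra S) (eB : B -> D) (eC : C -> D),
    [/\ K D, is_hom eB /\ injective eB, is_hom eC /\ injective eC
      & forall a : A, eB (iB a) = eC (iC a)].

Definition entails (S : signature) (X : Type) (K : algebra S -> Prop)
    (Theta : set (equation S X)) (e : equation S X) : Prop :=
  forall A : algebra S, K A ->
  forall h : Fm S X -> A, is_hom h ->
    (forall t, Theta t -> h t.1 = h t.2) -> h e.1 = h e.2.

Record logic (S : signature) (X : Type) := Logic {
  derives :> set (formula S X) -> formula S X -> Prop;
  derives_refl : forall G p, G p -> derives G p;
  derives_mono : forall G G' p, G `<=` G' -> derives G p -> derives G' p;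
  derives_cut : forall G D p,
    (forall q, D q -> derives G q) -> derives (G `|` D) p -> derives G p;
  derives_finitary : forall G p, derives G p ->
    exists G0, [/\ finite_set G0, G0 `<=` G & derives G0 p];
  derives_subst : forall (s : Fm S X -> Fm S X), is_hom s ->
    forall G p, derives G p -> derives (s @` G) (s p)
}.

(** [t(p)] for a formula [t] in at most one variable: substituting [p] for
    every variable is then the same as substituting it for that one. *)
Definition plug (S : signature) (X : Type) (t p : formula S X) : formula S X :=
  @eval S X (Fm S X) (fun=> p) t.

Definition plug_eq (S : signature) (X : Type) (e : equation S X)
    (p : formula S X) : equation S X := (plug e.1 p, plug e.2 p).

Definition algebraic_semantics (S : signature) (X : Type) (l : logic S X)
    (K : algebra S -> Prop) (x : X) (e : equation S X) : Prop :=
  [/\ vars e.1 `<=` [set x], vars e.2 `<=` [set x]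
    & forall (G : set (formula S X)) (p : formula S X),
        l G p <-> entails K (plug_eq e @` G) (plug_eq e p)].

Definition craig_interpolation (S : signature) (X : Type) (l : logic S X) : Prop :=
  forall (G : set (formula S X)) (p : formula S X), l G p ->
  exists G' : set (formula S X),
    [/\ set_vars G' `<=` set_vars G `&` vars p,
        (forall g, G' g -> l G g)
      & l G' p].

(* Main.v *)
From mathcomp Require Import all_boot.
From mathcomp Require Import boolp classical_sets functions cardinality.
Require Import Defs.

(** A regular variety is closed under adjoining an absorbing element [None] to
    an algebra.  If the variable occurs in the regular equation [e], a valuation
    sending the variables outside [vars p] to [None] makes the [e]-translation of
    every premise that has such a variable trivially true.  Hence [p] already
    follows from the premises whose variables lie in [vars p], and these form the
    interpolant.  If [e] is closed, all formulas have the same translation, and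
    the closed formula [e.1] interpolates any consequence of a nonempty set. *)

Set Implicit Arguments.
Unset Strict Implicit.
Unset Printing Implicit Defensive.

Local Open Scope classical_set_scope.

Section Evaluation.
Context {S : signature} {X : Type}.
Implicit Types (A : algebra S) (t p : formula S X).

Lemma eval_is_hom A (v : X -> A) : is_hom (eval v : Fm S X -> A).
Proof. by []. Qed.

Lemma hom_evalE A (h : Fm S X -> A) t :
  is_hom h -> h t = eval (fun y => h (Var y)) t.
Proof.
move=> hom_h; elim: t => [//|o args IH] /=.
rewrite (hom_h o args); congr interp; exact/funext.
Qed.

(** The value of a translated formula depends only on the value of the formula plugged in; this lets
    [None] spread from a premise to both sides of its translation. *)
Lemma hom_plug A (h : Fm S X -> A) t p :
  is_hom h -> h (plug t p) = eval (fun=> h p) t.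
Proof.
move=> hom_h; rewrite /plug; elim: t => [//|o args IH] /=.
rewrite (hom_h o); congr interp; exact/funext.
Qed.

Lemma plug_closed t p q : vars t = set0 -> plug t p = plug t q.
Proof.
rewrite /plug; elim: t => [y /= /seteqP[/(_ y erefl)]//|o args IH /=].
move=> /seteqP[t0 _]; congr App; apply/funext => i; apply: IH.
by apply/seteqP; split=> // y yi; apply: (t0 y); exists i.
Qed.

End Evaluation.

Section Absorbing.
Context {S : signature}.
Implicit Type A : algebra S.

(** The choice of [b] is harmless, because [Some] is injective. A constant keeps its value from [A]:
    its empty tuple of arguments factors through [Some]. *)
Definition absorb A : algebra S :=
  @Algebra S (option A) (fun o a =>
    if pselect (exists b, a = Some \o b) is left ex_b
    then Some (interp (projT1 (cid ex_b))) else None).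

Lemma absorb_interp_some A (o : op_sym S) (b : 'I_(arity o) -> A) :
  @interp S (absorb A) o (fun i => Some (b i)) = Some (interp b).
Proof.
rewrite /=; case: pselect => [ex_b|[]]; last by exists b.
case: cid => c /= eq_bc; congr (Some (interp _)); apply/funext => i.
by have /(congr1 (@^~ i)) [] := eq_bc.
Qed.

Lemma absorb_interp_none A (o : op_sym S) (a : 'I_(arity o) -> absorb A) i :
  a i = None -> interp a = None.
Proof.
by move=> ai; rewrite /=; case: pselect => // -[b ab]; have := congr1 (@^~ i) ab; rewrite /= ai.
Qed.

Lemma absorb_eval_some A X (v : X -> absorb A) (w : X -> A) (t : formula S X) :
  (forall y, vars t y -> v y = Some (w y)) -> eval v t = Some (eval w t).
Proof.
elim: t => [y /(_ y erefl)//|o args IH] vw.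
rewrite -[LHS]/(interp (fun i => eval v (args i))).
rewrite -[RHS]/(Some (interp (fun i => eval w (args i)))) -absorb_interp_some.
congr interp; apply/funext => i; apply: IH => y yi.
by apply: vw; exists i.
Qed.

Lemma absorb_eval_none A X (v : X -> absorb A) (t : formula S X) y :
  vars t y -> v y = None -> eval v t = None.
Proof.
elim: t => [z /= -> //|o args IH] [i _ yi] vy.
exact: (absorb_interp_none (i := i) (IH i yi vy)).
Qed.

(** By regularity a variable sent to [None] occurs on both sides or on neither: either both sides
    are [None], or the evaluation takes place inside [A]. *)
Lemma absorb_satisfies A (e : equation S nat) :
  regular e -> satisfies A e -> satisfies (absorb A) e.
Proof.
move=> reg_e Ae h hom_h; rewrite !(hom_evalE _ hom_h).
set v := fun y => h (Var y).
(* An empty [A] offers no default value for [w] below, but then [absorb A] is a single point. *)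
have [[a0]|A0] := pselect (inhabited A); last first.
  have None_only (u : absorb A) : u = None.
    by case: u => // a; case: A0.
  by rewrite [LHS]None_only [RHS]None_only.
have [[y ye vy]|v_some] := pselect (exists2 y, vars e.1 y & v y = None).
  rewrite (absorb_eval_none ye vy); move: ye; rewrite reg_e => ye.
  by rewrite (absorb_eval_none ye vy).
(* The default [a0] is only taken at variables outside [e.1], where the value is irrelevant. *)
pose w y := odflt a0 (v y).
have vw y : vars e.1 y -> v y = Some (w y).
  by rewrite /w; case vy: (v y) => [//|] ye; case: v_some; exists y.
rewrite (absorb_eval_some vw) (absorb_eval_some (w := w)); last first.
  by rewrite -reg_e.
by rewrite (Ae _ (eval_is_hom w)).
Qed.

Lemma regular_variety_absorb (K : algebra S -> Prop) A :
  regular_variety K -> K A -> K (absorb A).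
Proof.
move=> [E [reg_E K_E]] /K_E KA; apply/K_E => e Ee.
exact: absorb_satisfies (reg_E _ Ee) (KA _ Ee).
Qed.

End Absorbing.

(** A model in [A] of the retained premises extends to a model in [absorb A] of all of [G];
    injectivity of [Some] brings the conclusion back to [A]. *)
Lemma entails_relevant_premises (S : signature) (K : algebra S -> Prop)
    (X : Type) (x : X) (e : equation S X) (G : set (formula S X)) p :
  regular_variety K -> vars e.1 x -> vars e.2 x ->
  entails K (plug_eq e @` G) (plug_eq e p) ->
  entails K (plug_eq e @` [set g | G g /\ vars g `<=` vars p]) (plug_eq e p).
Proof.
move=> varK xe1 xe2 Gp A KA h hom_h sat_h.
pose v y : absorb A := if pselect (vars p y) then Some (h (Var y)) else None.
have v_some g : vars g `<=` vars p -> eval v g = Some (h g).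
  move=> gp; rewrite (hom_evalE _ hom_h); apply: absorb_eval_some => y /gp py.
  by rewrite /v; case: pselect.
have plug_some t g : vars g `<=` vars p -> eval v (plug t g) = Some (h (plug t g)).
  move=> gp; rewrite (hom_plug t g (eval_is_hom v)) (hom_plug _ _ hom_h).
  by apply: absorb_eval_some => y _; exact: v_some.
have /= := Gp _ (regular_variety_absorb varK KA) _ (eval_is_hom v).
rewrite !plug_some // => Gp'.
suff /Gp'[]: forall q, (plug_eq e @` G) q -> eval v q.1 = eval v q.2 by [].
move=> _ [g Gg <-] /=.
have [gp|/existsNP[y /not_implyP[yg yp]]] := pselect (vars g `<=` vars p).
  by rewrite !plug_some //; congr Some; apply: (sat_h (plug_eq e g)); exists g.
have v_none : eval v g = None.
  by apply: absorb_eval_none yg _; rewrite /v; case: pselect.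
(* Since [x] occurs in both sides of [e], both sides of the translation of [g] become [None]. *)
rewrite !(hom_plug _ g (eval_is_hom v)).
by rewrite (absorb_eval_none xe1 v_none) (absorb_eval_none xe2 v_none).
Qed.

Theorem corollary5p16 :
  forall (S : signature) (K : algebra S -> Prop),
    regular_variety K ->
    amalgamation_property K ->
    forall (X : Type) (l : logic S X) (x : X) (e : equation S X),
      regular e ->
      algebraic_semantics l K x e ->
      craig_interpolation l.
Proof.
move=> S K varK _ X l x e reg_e [e1x _ lE] G p Gp.
have [xe|xe] := pselect (vars e.1 x).
  exists [set g | G g /\ vars g `<=` vars p]; split.
  - by move=> y [g [Gg gp] yg]; split; [exists g | exact: gp].
  - by move=> g [Gg _]; exact: derives_refl.
  - apply/lE; apply: (entails_relevant_premises (x := x)) => //.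
      by rewrite -reg_e.
    exact/lE.
have e1_0 : vars e.1 = set0.
  by apply/seteqP; split=> // y ye; apply: xe; rewrite -(e1x _ ye).
have e2_0 : vars e.2 = set0 by rewrite -reg_e.
have translE q r : plug_eq e q = plug_eq e r.
  by congr (_, _); exact: plug_closed.
have derives_any q g r : q g -> l q r.
  move=> qg; apply/lE => A _ h _ sat_h; apply: sat_h.
  by exists g => //; exact: translE.
have [[g Gg]|G0] := pselect (exists g, G g).
  exists [set e.1]; split.
  - by move=> y [_ ->]; rewrite e1_0.
  - by move=> q _; exact: derives_any Gg.
  - exact: (derives_any _ e.1).
(* Without premises [p] is a theorem, so the empty set interpolates. *)
exists set0; split=> //; first by move=> y [].
by apply: derives_mono Gp => g Gg; case: G0; exists g.
Qed.
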